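(* There exists a homeomorphism $G:[0,1]^{\mathbb{N}}\to[-1,1]^{\mathbb{N}}$ such that $\sup_n|G(x)_n|=\sup_n x_n$ for all $x\in[0,1]^{\mathbb{N}}$.
   Context: The spaces $[0,1]^{\mathbb{N}}$ and $[-1,1]^{\mathbb{N}}$ carry the product topology. *)

(* Defs.v *)
From mathcomp Require Import all_boot all_order all_algebra.
From mathcomp Require Import all_classical all_reals all_analysis.

Set Implicit Arguments.
Unset Strict Implicit.
Unset Printing Implicit Defensive.

Import Order.TTheory GRing.Theory Num.Theory.
Import numFieldNormedType.Exports.

Local Open Scope classical_set_scope.
Local Open Scope ring_scope.

(* [a, b] is a subtype of R with the topology induced by the inclusion into R
   (not the [subspace] construction, which keeps the points outside [a, b]). *)
Definition cube (R : realType) (a b : R) : topologicalType :=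
  prod_topology (fun _ : nat => set_type `[a, b]%classic).

Definition homeomorphism (X Y : topologicalType) (f : X -> Y) : Prop :=
  continuous f /\
  exists g : Y -> X, [/\ cancel f g, cancel g f & continuous g].

(* Main.v *)
(* The sets { max (p, q) = 1 } in [0, 1]^2 and { max (|u|, v) = 1 } in
   [-1, 1] x [0, 1] are both arcs. A piecewise linear homeomorphism between
   them, extended homogeneously, gives
     h : [0, 1]^2 -> [-1, 1] x [0, 1],
     h (p, q) = (min (p, max (- q, 3 p - 2 q)), min (3 p, q)),
   which preserves the maximum of the absolute values and has the inverse
     (u, v) |-> (max (u, v / 3, (u + 2 v) / 3), max (- u, v)).
   Put c_0 = x_0 and (y_n, c_{n+1}) = h (c_n, x_{n+1}); then G (x) = y.
   The first coordinate of the inverse of h is 2/3-Lipschitz in v, so the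
   backward recursion for c_n in terms of y_n and c_{n+1} is a contraction: y
   alone determines every c_n, as a uniform limit of functions of finitely many
   y_k, and hence x. The contraction also prevents the supremum of x from
   escaping to infinity: if |y_k| <= M for all k, then all c_n are at most M, and
   so are all x_n. *)
Require Import Defs.
From mathcomp Require Import all_boot all_order all_algebra.
From mathcomp Require Import all_classical all_reals all_analysis.
From mathcomp Require Import lra.
Local Open Scope classical_set_scope.
Local Open Scope ring_scope.

Set Implicit Arguments.
Unset Strict Implicit.
Unset Printing Implicit Defensive.

Import Order.TTheory GRing.Theory Num.Theory.
Import numFieldNormedType.Exports.

(* Innermost first, so that the comparisons handed to [lra] are linear. *)
Ltac split_minmax :=
  repeat match goal with
  | |- context [Order.max ?a ?b] =>
      lazymatch constr:((a, b)) with
      | context [Order.max _ _] => fail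
      | context [Order.min _ _] => fail
      | _ => case: (leP a b) => ?
      end
  | |- context [Order.min ?a ?b] =>
      lazymatch constr:((a, b)) with
      | context [Order.max _ _] => fail
      | context [Order.min _ _] => fail
      | _ => case: (leP a b) => ?
      end
  end.

Section ContinuousMinMax.
Context {R : realType} {T : topologicalType}.
Implicit Types f g : T -> R.

Lemma continuous_fun_max f g : continuous f -> continuous g ->
  continuous (fun t => Num.max (f t) (g t)).
Proof. by move=> cf cg t; exact: (continuous_max (cf t) (cg t)). Qed.

Lemma continuous_fun_min f g : continuous f -> continuous g ->
  continuous (fun t => Num.min (f t) (g t)).
Proof. by move=> cf cg t; exact: (continuous_min (cf t) (cg t)). Qed.

End ContinuousMinMax.

(** * The folding recursion on real sequences and its inverse *)

Section Folding.
Variable R : realType.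
Implicit Types (x y t : nat -> R) (u v M : R) (k n : nat).

(* [carry x n] and [fold_signs x n] are the c_n and y_n of the header. *)
Fixpoint carry x n : R :=
  if n is m.+1 then Num.min (3 * carry x m) (x m.+1) else x 0%N.

Definition fold_signs x n : R :=
  Num.min (carry x n) (Num.max (- x n.+1) (3 * carry x n - 2 * x n.+1)).

(* First coordinate of the inverse of h. *)
Definition uncarry_step u v : R :=
  Num.max u (Num.max (v / 3) ((u + 2 * v) / 3)).

(** The backward recursion cut off after [k] steps: 0 replaces the unknown c_{n+k} and, as its least
    possible value, makes the approximations increase with [k]. *)
Fixpoint uncarry_approx k y n : R :=
  if k is j.+1 then uncarry_step (y n) (uncarry_approx j y n.+1) else 0.

Definition uncarry y n : R := limn (fun k => uncarry_approx k y n).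

Definition unfold_signs y n : R :=
  if n is m.+1 then Num.max (- y m) (uncarry y m.+1) else uncarry y 0%N.

Lemma carry_ge0 x : (forall n, 0 <= x n) -> forall n, 0 <= carry x n.
Proof.
move=> x0; elim=> //= n IHn.
by move: (x0 n.+1); split_minmax; lra.
Qed.

Lemma carry_itv x M : (forall n, 0 <= x n <= M) ->
  forall n, 0 <= carry x n <= M.
Proof.
move=> xM; elim=> [|n IHn] /=; first exact: xM.
by move: (xM n.+1) IHn => /andP[? ?] /andP[? ?]; apply/andP; split_minmax; lra.
Qed.

(** One half of the equality of suprema, which is why [M] is arbitrary rather than 1. *)
Lemma normr_fold_signs x M : (forall n, 0 <= x n <= M) ->
  forall n, `|fold_signs x n| <= M.
Proof.
move=> xM n; rewrite ler_norml /fold_signs.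
move: (xM n.+1) (carry_itv xM n) => /andP[? ?] /andP[? ?].
by split_minmax; lra.
Qed.

Lemma fold_signsK_step x n : (forall n, 0 <= x n) ->
  uncarry_step (fold_signs x n) (carry x n.+1) = carry x n.
Proof.
move=> x0; have c0 := carry_ge0 x0 n; move: (x0 n.+1) => ?.
by rewrite /uncarry_step /fold_signs /=; split_minmax; lra.
Qed.

Lemma fold_signsK_next x n : (forall n, 0 <= x n) ->
  Num.max (- fold_signs x n) (carry x n.+1) = x n.+1.
Proof.
move=> x0; have c0 := carry_ge0 x0 n; move: (x0 n.+1) => ?.
by rewrite /fold_signs /=; split_minmax; lra.
Qed.

(** In [v], the step is a maximum of affine functions of slopes 0, 1/3 and 2/3. *)
Lemma uncarry_step_lipschitz u v w :
  `|uncarry_step u v - uncarry_step u w| <= 2 / 3 * `|v - w|.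
Proof.
by rewrite /uncarry_step; case: (ger0P (v - w)) => ?; rewrite ler_norml;
  split_minmax; lra.
Qed.

Lemma uncarry_step_ge0 u v : 0 <= v -> 0 <= uncarry_step u v.
Proof. by move=> ?; rewrite /uncarry_step; split_minmax; lra. Qed.

Lemma uncarry_step_le u v M : 0 <= v -> u <= M -> v <= M ->
  uncarry_step u v <= M.
Proof. by move=> ? ? ?; rewrite /uncarry_step; split_minmax; lra. Qed.

Lemma le_uncarry_step u v w : v <= w -> uncarry_step u v <= uncarry_step u w.
Proof. by move=> ?; rewrite /uncarry_step; split_minmax; lra. Qed.

Lemma uncarry_approx_itv y M : 0 <= M -> (forall n, y n <= M) ->
  forall k n, 0 <= uncarry_approx k y n <= M.
Proof.
move=> M0 yM; elim=> [|k IHk] n /=; first by rewrite lexx.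
have /andP[a0 aM] := IHk n.+1.
by rewrite uncarry_step_ge0 //= uncarry_step_le.
Qed.

Lemma uncarry_approx_nondecreasing y n :
  nondecreasing_seq (fun k => uncarry_approx k y n).
Proof.
apply/nondecreasing_seqP => k; elim: k n => [|k IHk] n /=.
  exact: uncarry_step_ge0.
exact: le_uncarry_step (IHk n.+1).
Qed.

(** Monotone convergence gives the limit; the contraction serves for uniqueness and for continuity
    in [y]. *)
Lemma uncarry_approx_cvg y M : 0 <= M -> (forall n, y n <= M) ->
  forall n, uncarry_approx k y n @[k --> \oo] --> uncarry y n.
Proof.
move=> M0 yM n; apply: nondecreasing_is_cvgn.
  exact: uncarry_approx_nondecreasing.
by exists M => _ [k _ <-]; have /andP[] := uncarry_approx_itv M0 yM k n.
Qed.

Lemma uncarry_itv y M : 0 <= M -> (forall n, y n <= M) ->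
  forall n, 0 <= uncarry y n <= M.
Proof.
move=> M0 yM n; have cv := @uncarry_approx_cvg y M M0 yM n.
apply/andP; split.
  apply: limr_ge; first exact: cvgP cv.
  by apply: nearW => k; have /andP[] := uncarry_approx_itv M0 yM k n.
apply: limr_le; first exact: cvgP cv.
by apply: nearW => k; have /andP[] := uncarry_approx_itv M0 yM k n.
Qed.

Lemma uncarry_step_continuous u : continuous (uncarry_step u).
Proof.
apply: continuous_fun_max => [v|]; first exact: cvg_cst.
apply: continuous_fun_max => v; apply: cvgMl; first exact: cvg_id.
by apply: cvgD; [exact: cvg_cst|apply: cvgMr; exact: cvg_id].
Qed.

(** The step is continuous, so the recursion passes to the limit. *)
Lemma uncarryE y M n : 0 <= M -> (forall n, y n <= M) ->
  uncarry y n = uncarry_step (y n) (uncarry y n.+1).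
Proof.
move=> M0 yM; have cv := @uncarry_approx_cvg y M M0 yM n.
have cvS : uncarry_approx k.+1 y n @[k --> \oo] --> uncarry y n.
  by rewrite (cvg_shiftS (fun k => uncarry_approx k y n)).
apply: (cvg_unique _ cvS) => //=.
apply: continuous_cvg; first exact: uncarry_step_continuous.
exact: @uncarry_approx_cvg y M M0 yM n.+1.
Qed.

(** The error is at most 1 at index n + k, where 0 replaces t_{n+k}, and each step back multiplies
    it by at most 2/3. *)
Lemma uncarry_approx_dist y t k n : (forall n, 0 <= t n <= 1) ->
  (forall n, t n = uncarry_step (y n) (t n.+1)) ->
  `|t n - uncarry_approx k y n| <= (2 / 3) ^+ k.
Proof.
move=> t01 tE; elim: k n => [|k IHk] n /=.
  by rewrite subr0 expr0 ger0_norm; have /andP[] := t01 n.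
rewrite tE exprS (le_trans (uncarry_step_lipschitz _ _ _)) //.
by apply: ler_pM => //; lra.
Qed.

(** Applied to [carry x], this recovers the carries from the folded sequence alone. *)
Lemma uncarry_unique y t n : (forall n, 0 <= t n <= 1) ->
  (forall n, t n = uncarry_step (y n) (t n.+1)) -> uncarry y n = t n.
Proof.
move=> t01 tE; apply: cvg_lim => //.
have e0 : ((2 / 3 : R) ^+ k) @[k --> \oo] --> (0 : R).
  by apply: cvg_expr; rewrite ger0_norm; lra.
apply/cvgrPdist_le => e e_gt0.
move/cvgrPdist_le : e0 => /(_ e e_gt0); apply: filterS => k.
rewrite sub0r normrN => /(le_trans (ler_norm _)).
exact: le_trans (uncarry_approx_dist _ _ _ _).
Qed.

Lemma fold_signsK x : (forall n, 0 <= x n <= 1) ->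
  unfold_signs (fold_signs x) =1 x.
Proof.
move=> x01; have x0 n : 0 <= x n by have /andP[] := x01 n.
have cE n : uncarry (fold_signs x) n = carry x n.
  apply: uncarry_unique; first exact: carry_itv.
  by move=> m; rewrite fold_signsK_step.
by case=> [|n] /=; rewrite cE // fold_signsK_next.
Qed.

(** With (p, q) the inverse image of (u, v) under h, min (3 p, q) returns v as soon as v >= 0. *)
Lemma carry_unfold_signs y M n : 0 <= M -> (forall n, y n <= M) ->
  carry (unfold_signs y) n = uncarry y n.
Proof.
move=> M0 yM; elim: n => //= n ->; rewrite (uncarryE n M0 yM) /uncarry_step.
have /andP[+ _] := uncarry_itv M0 yM n.+1.
by move=> ?; split_minmax; lra.
Qed.

Lemma unfold_signsK y M : 0 <= M -> (forall n, y n <= M) ->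
  fold_signs (unfold_signs y) =1 y.
Proof.
move=> M0 yM n; rewrite /fold_signs (carry_unfold_signs _ M0 yM) /=.
rewrite (uncarryE n M0 yM) /uncarry_step.
have /andP[+ _] := uncarry_itv M0 yM n.+1.
by move=> ?; split_minmax; lra.
Qed.

(** The other half of the equality of suprema. *)
Lemma unfold_signs_itv y M : (forall n, `|y n| <= M) ->
  forall n, 0 <= unfold_signs y n <= M.
Proof.
move=> yM; have M0 : 0 <= M := le_trans (normr_ge0 _) (yM 0%N).
have yM' n : y n <= M := le_trans (ler_norm _) (yM n).
case=> [|n] /=; first exact: uncarry_itv.
have := uncarry_itv M0 yM' n.+1; move: (yM n); rewrite ler_norml.
by move=> /andP[? ?] /andP[? ?]; apply/andP; split_minmax; lra.
Qed.

End Folding.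

(** * Coordinates and continuity in the cubes *)

Section Cube.
Context {R : realType} {a b : R}.

Lemma set_val_cube_itv (x : cube a b) n : a <= set_val (x n) <= b.
Proof. by have := set_valP (x n); rewrite /= in_itv. Qed.

Lemma eq_cube (x y : cube a b) :
  (forall n, set_val (x n) = set_val (y n)) -> x = y.
Proof.
by move=> xy; apply: functional_extensionality_dep => n; exact/val_inj/xy.
Qed.

Lemma cube_coord_continuous n :
  continuous (fun x : cube a b => set_val (x n)).
Proof.
move=> x; apply: (@continuous_comp _ _ _ (fun x : cube a b => x n) set_val).
  exact: (@proj_continuous nat (fun=> set_type `[a, b]%classic) n).
exact: initial_continuous.
Qed.

Lemma continuous_to_cube (T : topologicalType) (f : T -> cube a b) :
  (forall n, continuous (fun t => set_val (f t n))) -> continuous f.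
Proof.
move=> cf t; apply/cvg_sup => n A /= [_ [[B Bop <-] Bft] BA].
(* An open set of the interval is the trace of an open set [W] of the line. *)
have [W oW WB] := Bop; rewrite -WB /= in Bft BA.
apply: filterS BA _; apply: (cf n t).
exact: open_nbhs_nbhs.
Qed.

End Cube.

(** * Continuity of both recursions in a parameter *)

Section FoldingContinuity.
Context {R : realType} {T : topologicalType}.
Variable x : T -> nat -> R.
Hypothesis x_continuous : forall n, continuous (x ^~ n).

Lemma carry_continuous n : continuous (fun t => carry (x t) n).
Proof.
elim: n => [|n IHn] /=; first exact: x_continuous.
apply: continuous_fun_min => [t|]; last exact: x_continuous.
by apply: cvgMr; exact: IHn.
Qed.

Lemma fold_signs_continuous n : continuous (fun t => fold_signs (x t) n).
Proof.
apply: continuous_fun_min; first exact: carry_continuous.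
apply: continuous_fun_max => t; first by apply: cvgN; exact: x_continuous.
by apply: cvgB; apply: cvgMr; [exact: carry_continuous|exact: x_continuous].
Qed.

Lemma uncarry_approx_continuous k n :
  continuous (fun t => uncarry_approx k (x t) n).
Proof.
elim: k n => [|k IHk] n /=; first by move=> t; exact: cvg_cst.
apply: continuous_fun_max; first exact: x_continuous.
apply: continuous_fun_max => t; apply: cvgMl; first exact: IHk.
by apply: cvgD; [exact: x_continuous|apply: cvgMr; exact: IHk].
Qed.

Hypothesis x_le1 : forall t n, x t n <= 1.

Lemma uncarry_continuous n : continuous (fun t => uncarry (x t) n).
Proof.
(* The bound is the same for all [t]: the approximations converge uniformly. *)
have near_approx k t :
    `|uncarry (x t) n - uncarry_approx k (x t) n| <= (2 / 3) ^+ k.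
  apply: uncarry_approx_dist => m; first exact: (uncarry_itv _ (x_le1 t) m).
  exact: (uncarryE _ _ (x_le1 t)).
move=> t; apply/cvgrPdist_lt => e e_gt0.
have e3 : 0 < e / 3 by lra.
have [k ke] : exists k, (2 / 3 : R) ^+ k < e / 3.
  have : ((2 / 3 : R) ^+ k) @[k --> \oo] --> (0 : R).
    by apply: cvg_expr; rewrite ger0_norm; lra.
  move/cvgrPdist_lt => /(_ _ e3) [k _ /(_ k (leqnn k))] /=.
  by rewrite sub0r normrN => /(le_lt_trans (ler_norm _)); exists k.
(* One third of [e] for the variation of the approximation, one for the error at each of the two
   points. *)
have /cvgrPdist_lt/(_ _ e3) := @uncarry_approx_continuous k n t.
apply: filterS => z; move: (near_approx k t) (near_approx k z).
by rewrite !ler_norml !ltr_norml; lra.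
Qed.

Lemma unfold_signs_continuous n : continuous (fun t => unfold_signs (x t) n).
Proof.
case: n => [|n] /=; first exact: uncarry_continuous.
apply: continuous_fun_max => [t|]; last exact: uncarry_continuous.
by apply: cvgN; exact: x_continuous.
Qed.

End FoldingContinuity.

(** On nonempty sets, [sup] is defined through the set of upper bounds alone. *)
Lemma sup_range_eq (R : realType) (f g : nat -> R) :
  (forall M, (forall n, f n <= M) <-> (forall n, g n <= M)) ->
  sup (range f) = sup (range g).
Proof.
move=> fg; have ubE : ubound (range f) = ubound (range g).
  have rangeP (h : nat -> R) M : ubound (range h) M <-> forall n, h n <= M.
    by split=> [hM n|hM _ [n _ <-]] //; apply: hM; exists n.
  by apply/seteqP; split=> M /rangeP/fg/rangeP.
have range_neq0 (h : nat -> R) : (range h == set0) = false.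
  by apply/negbTE/set0P; exists (h 0%N), 0%N.
by rewrite /sup /supremum /supremums ubE !range_neq0.
Qed.

Theorem corollary4 (R : realType) :
  exists G : cube (0 : R) 1 -> cube (-1 : R) 1,
    homeomorphism G /\
    forall x : cube (0 : R) 1,
      sup (range (fun n : nat => `|set_val (G x n)|)) =
      sup (range (fun n : nat => set_val (x n))).
Proof.
have fold_in (x : cube (0 : R) 1) n :
    fold_signs (set_val \o x) n \in `[-1, 1]%classic.
  rewrite inE /= in_itv /= -ler_norml; apply: normr_fold_signs => m.
  exact: set_val_cube_itv.
have norm_le1 (y : cube (-1 : R) 1) n : `|set_val (y n)| <= 1.
  by rewrite ler_norml set_val_cube_itv.
have unfold_in (y : cube (-1 : R) 1) n :
    unfold_signs (set_val \o y) n \in `[0, 1]%classic.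
  by rewrite inE /= in_itv /= unfold_signs_itv // => m; exact: norm_le1.
pose G (x : cube (0 : R) 1) : cube (-1 : R) 1 := fun n => SigSub (fold_in x n).
pose H (y : cube (-1 : R) 1) : cube (0 : R) 1 :=
  fun n => SigSub (unfold_in y n).
have HK : cancel G H.
  move=> x; apply: eq_cube => n.
  by apply: (@fold_signsK R (set_val \o x)) => m; exact: set_val_cube_itv.
have GK : cancel H G.
  move=> y; apply: eq_cube => n.
  apply: (@unfold_signsK R (set_val \o y) 1) => // m.
  exact: le_trans (ler_norm _) (norm_le1 y m).
exists G; split.
  split.
    apply: continuous_to_cube => n.
    (* The coordinates of [G] are convertible to [fold_signs (X x) n], the form of the continuity
       lemma. *)
    pose X (x : cube (0 : R) 1) := set_val \o x.
    suff : continuous (fun x => fold_signs (X x) n) by [].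
    apply: fold_signs_continuous => m; exact: cube_coord_continuous.
  exists H; split=> //; apply: continuous_to_cube => n.
  pose Y (y : cube (-1 : R) 1) := set_val \o y.
  suff : continuous (fun y => unfold_signs (Y y) n) by [].
  apply: unfold_signs_continuous => [m|].
    exact: cube_coord_continuous.
  by move=> y m; exact: le_trans (ler_norm _) (norm_le1 y m).
move=> x; apply: sup_range_eq => M; split=> [GM n|xM n].
  (* Seeing [x] as [H (G x)] turns a bound on [G x] into one on [x]. *)
  rewrite -[x]HK.
  by have /andP[] := @unfold_signs_itv R (set_val \o G x) M GM n.
apply: normr_fold_signs => m; rewrite /= xM andbT.
by have /andP[] := set_val_cube_itv x m.
Qed.
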